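(* If $C\subseteq\mathbb{R}^\infty$ is a set such that $\mathbb{H}\leq_{BSS} C$, then $|C|=2^\omega$.
   Context: BSS machines over $\mathbb{R}$: $\mathbb{R}^\infty$ is the set of finite tuples of reals. A BSS machine has a program with finitely many real constants (parameters); it can apply $+,-,\times,\div$ to cell contents, copy cells, overwrite a cell with $0$, and branch on whether a cell's content is $=0$, $<0$ or $>0$. Programs (including their real parameters) are coded by tuples in $\mathbb{R}^\infty$. $\mathbb{H}\subseteq\mathbb{R}^\infty$ is the halting problem for BSS computation: the set of tuples $\langle \vec p,\vec x\rangle$ such that the BSS program coded by $\vec p$ halts on input $\vec x$. An oracle BSS machine with oracle $B\subseteq\mathbb{R}^\infty$ may additionally branch on whether a previously computed tuple lies in $B$. $B\leq_{BSS}A$ means the characteristic function of $B$ is computed by some oracle BSS machine (with real parameters allowed) using oracle $A$. *)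

(* Defs.v *)
From HB Require Import structures.
From mathcomp Require Import all_boot all_order all_algebra.
From mathcomp Require Import boolp classical_sets functions cardinality reals.

Set Implicit Arguments.
Unset Strict Implicit.
Unset Printing Implicit Defensive.

Import Order.TTheory GRing.Theory Num.Theory.

Local Open Scope ring_scope.
Local Open Scope classical_set_scope.

(* BSS machines in the style of Blum, Cucker, Shub and Smale: the memory is a
   two-way infinite tape of reals, indexed by int. Instructions use fixed
   addresses, and the two shifts, which translate the whole tape by one cell,
   give access to inputs of arbitrary length. R^oo is seq R. *)

(* The real parameters of a program are the constants in its
   IConst instructions. *)
Inductive instr (R : Type) : Type :=
| IConst of int & R
| IZero of int
| ICopy of int & int
| IAdd of int & int & int
| ISub of int & int & int
| IMul of int & int & int
| IDiv of int & int & int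
| IShiftL
| IShiftR
| IBranch of int & nat & nat & nat. (* targets for = 0, < 0, > 0 *)

Arguments IZero {R}.
Arguments ICopy {R}.
Arguments IAdd {R}.
Arguments ISub {R}.
Arguments IMul {R}.
Arguments IDiv {R}.
Arguments IShiftL {R}.
Arguments IShiftR {R}.
Arguments IBranch {R}.

Definition program (R : Type) : Type := seq (instr R).

Inductive oinstr (R : Type) : Type :=
| Basic of instr R
| Query of nat & nat. (* targets for a positive and a negative answer *)

Arguments Query {R}.

Definition oprogram (R : Type) : Type := seq (oinstr R).

Record config (R : Type) : Type := Config { pc : nat; tape : int -> R }.

Section Machines.
Variable R : realType.
Implicit Types (t : int -> R) (x y : seq R) (p : program R) (P : oprogram R).
Implicit Types (c : config R) (A B : set (seq R)).

(* The tuple x is placed in the cells 0, ..., size x - 1; its length is given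
   in unary by 1s in the cells -1, ..., - size x. All other cells contain 0.
   Recall that Negz k is the integer - (k + 1). *)
Definition load x : int -> R := fun i =>
  match i with Posz k => x`_k | Negz k => (k < size x)%N%:R end.

(* The tuple held by a tape: its length is the length of the maximal block of
   1s immediately to the left of cell 0. *)
Definition holds t x : Prop :=
  [/\ forall k, (k < size x)%N -> t (Negz k) = 1,
      t (Negz (size x)) <> 1
    & forall k, (k < size x)%N -> t (Posz k) = x`_k].

(* A division by zero is repeated forever, so that the machine diverges. *)
Definition exec (ins : instr R) c : config R :=
  let: Config n t := c in
  match ins with
  | IConst i a => Config n.+1 [eta t with i |-> a]
  | IZero i => Config n.+1 [eta t with i |-> 0]
  | ICopy i j => Config n.+1 [eta t with i |-> t j]
  | IAdd i j k => Config n.+1 [eta t with i |-> t j + t k]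
  | ISub i j k => Config n.+1 [eta t with i |-> t j - t k]
  | IMul i j k => Config n.+1 [eta t with i |-> t j * t k]
  | IDiv i j k =>
      if t k == 0 then c else Config n.+1 [eta t with i |-> t j / t k]
  | IShiftL => Config n.+1 (fun i => t (i + 1))
  | IShiftR => Config n.+1 (fun i => t (i - 1))
  | IBranch i leq0 llt0 lgt0 =>
      Config (if t i == 0 then leq0 else if t i < 0 then llt0 else lgt0) t
  end.

(* A machine halts when its program counter leaves the program. *)
Definition step p c : config R :=
  if onth p (pc c) is Some ins then exec ins c else c.

Definition halts p x : Prop :=
  exists n, (size p <= pc (iter n (step p) (Config 0 (load x))))%N.

Definition ostep A P c : config R :=
  match onth P (pc c) with
  | None => c
  | Some (Basic ins) => exec ins c
  | Some (Query lyes lno) =>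
      Config (if `[< exists2 y, holds (tape c) y & A y >] then lyes else lno)
             (tape c)
  end.

Definition ocomputes A P x y : Prop :=
  exists n, let c := iter n (ostep A P) (Config 0 (load x)) in
    (size P <= pc c)%N /\ holds (tape c) y.

(* The characteristic function of B takes its values in R^1. *)
Definition bss_le B A : Prop :=
  exists P : oprogram R, forall x, ocomputes A P x [:: (x \in B)%:R].

(* The opcode determines the length of the code of an instruction, so that
   codes of programs are uniquely decodable. *)
Definition code_instr (ins : instr R) : seq R :=
  match ins with
  | IConst i a => [:: 0; i%:~R; a]
  | IZero i => [:: 1; i%:~R]
  | ICopy i j => [:: 2; i%:~R; j%:~R]
  | IAdd i j k => [:: 3; i%:~R; j%:~R; k%:~R]
  | ISub i j k => [:: 4; i%:~R; j%:~R; k%:~R]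
  | IMul i j k => [:: 5; i%:~R; j%:~R; k%:~R]
  | IDiv i j k => [:: 6; i%:~R; j%:~R; k%:~R]
  | IShiftL => [:: 7]
  | IShiftR => [:: 8]
  | IBranch i leq0 llt0 lgt0 => [:: 9; i%:~R; leq0%:R; llt0%:R; lgt0%:R]
  end.

Definition code p : seq R := flatten (map code_instr p).

Definition tuple_pair x y : seq R := (size x)%:R :: x ++ y.

Definition halting_problem : set (seq R) :=
  [set s | exists p x, s = tuple_pair (code p) x /\ halts p x].

End Machines.

Arguments halting_problem : clear implicits.

(* Main.v *)
(* The program [spiral] expands y greedily as a sum of terms +-c^i, and halts iff
   the expansion is finite, in which case y = g(c) for one of countably many
   polynomials g. Suppose that M decides halting with oracle C. Along a fixed
   path of M the cells are rational functions of (c, y). Let c and y avoid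
   countable sets, so that the spiral diverges on (c, y). The outcomes of the
   branches on the path of M at (c, y) persist at the points (c, g(c)) with g(c)
   close to y, and at some of these, with deg g large, the spiral halts. So some
   query of M, at (c, y) or at (c, g(c)), finds in C a tuple with an entry that is
   a nonconstant rational function of y, respectively of c. Either this varies
   with y for some c and all but countably many y, or it varies with c for all
   but countably many c. In both cases an interval is covered by countably many
   pieces with countable-to-one maps to C, and a diagonal argument turns this
   into an injection of the Cantor space into C. *)

Require Import Defs.
From mathcomp Require Import all_boot all_order all_algebra.
From mathcomp Require Import boolp classical_sets functions cardinality reals.
From mathcomp Require Import polyrcf ring lra zify.

Set Implicit Arguments.
Unset Strict Implicit.
Unset Printing Implicit Defensive.

Import Order.TTheory GRing.Theory Num.Theory.

Local Open Scope ring_scope.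
Local Open Scope classical_set_scope.

(** * Diagonalization over the Cantor space *)

(* A countable cover of the Cantor space has a piece which a column projection
   maps onto the whole Cantor space. *)
Lemma cover_cantor (D : countType) (G : D -> (nat -> bool) -> Prop) :
  (forall x, exists d, G d x) ->
  exists d (h : (nat -> bool) -> nat -> bool),
    injective h /\ forall b, G d (h b).
Proof.
move=> cover; pose col d (x : nat -> bool) n := x (pickle (d : D, n : nat)).
suff [d /choice[h hP]] : exists d, forall b, exists x, G d x /\ col d x = b.
  exists d, h; split=> [b b' ebb'|b]; last by have [] := hP b.
  by have [_ <-] := hP b; have [_ <-] := hP b'; rewrite ebb'.
apply: contrapT => /forallNP none.
have /choice[beta betaP] : forall d, exists b, forall x, G d x -> col d x <> b.
  move=> d; have /existsNP[b nb] := none d; exists b => x Gx xb.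
  by apply: nb; exists x.
(* The diagonal point: its column [d] is the sequence missed by the piece [d], so no piece contains
   it. *)
pose x n := if unpickle n is Some (d, m) then beta d m else false.
have [d /betaP[]] := cover x.
by apply/funext => n; rewrite /col /x pickleK.
Qed.

(** Numbering the countable fibres splits each piece into countably many on which the map to [C] is
    injective, and [E] into single points. By [cover_cantor] one of these contains an injective copy
    of the Cantor space. *)
Lemma cantor_le_of_cover (T U : Type) (e : (nat -> bool) -> T) (E : set T)
    (C : set U) (D : countType) (G : D -> T -> U -> Prop) :
  injective e -> countable E ->
  (forall b, ~ E (e b) -> exists d s, C s /\ G d (e b) s) ->
  (forall d s, countable [set x | G d x s]) ->
  ([set: nat -> bool] #<= C)%card.
Proof.
move=> e_inj /countable_injP[iE iEP] cover cntG.
have /choice[i iP] : forall d, exists i : U -> T -> nat, forall s x x',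
    G d x s -> G d x' s -> i s x = i s x' -> x = x'.
  move=> d; have /choice[i iP] : forall s, exists f : T -> nat,
      {in [set x | G d x s] &, injective f}.
    by move=> s; apply/countable_injP; apply: cntG.
  by exists i => s x x' Gx Gx'; apply: iP; rewrite inE.
pose H (k : nat + D * nat) (b : nat -> bool) := match k with
  | inl n => E (e b) /\ iE (e b) = n
  | inr (d, n) => exists s, [/\ C s, G d (e b) s & i d s (e b) = n] end.
have coverH b : exists k, H k b.
  have [Eb|/cover[d [s [Cs Gs]]]] := pselect (E (e b)).
    by exists (inl (iE (e b))).
  by exists (inr (d, i d s (e b))), s.
have [[n|[d n]] [h [h_inj hP]]] := cover_cantor coverH.
  (* A piece of [E] is a single point, so it contains no such copy. *)
  suff : (fun=> true) = (fun=> false) :> (nat -> bool) by move/(congr1 (@^~ 0%N)).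
  apply/h_inj/e_inj; have [E1 e1] := hP (fun=> true).
  by have [E2 e2] := hP (fun=> false); apply: iEP; rewrite ?inE ?e1 ?e2.
have /choice[s sP] := hP.
have s_inj : {in [set: nat -> bool] &, injective s}.
  move=> b b' _ _ sbb'; have [_ G1 e1] := sP b; have [_ G2 e2] := sP b'.
  rewrite -sbb' in G2 e2; apply/h_inj/e_inj/(iP _ _ _ _ G1 G2).
  by rewrite e1 e2.
apply: card_le_trans (subset_card_le (_ : s @` setT `<=` C)); last first.
  by move=> _ [b _ <-]; have [] := sP b.
by have /card_eqPle[] := inj_card_eq s_inj.
Qed.

(** * Tuples, real intervals and the Cantor space *)

Section Continuum.
Variable R : realType.
Implicit Types (b : nat -> bool) (x : seq R).

(** A tuple is coded by the rational cuts of its entries, a subset of [nat * rat]. Cuts at indices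
    beyond the tuple are empty, which records its length. *)
Lemma seq_card_le_cantor (A : set (seq R)) : (A #<= [set: nat -> bool])%card.
Proof.
apply: card_le_trans (subset_card_le (@subsetT _ A)) _.
pose below x (iq : nat * rat) := (iq.1 < size x)%N && (ratr iq.2 < x`_iq.1).
pose f x n := if unpickle n is Some iq then below x iq else false.
suff f_inj : {in [set: seq R] &, injective f}.
  apply: card_le_trans (subset_card_le (@subsetT _ (f @` setT))).
  by have /card_eqPle[] := inj_card_eq f_inj.
move=> x y _ _ fxy.
have belowE iq : below x iq = below y iq.
  by have := congr1 (@^~ (pickle iq)) fxy; rewrite /f pickleK.
have rat_below (a : R) : exists q : rat, ratr q < a.
  have /rat_in_itvoo[q] : a - 1 < a by rewrite ltrBlDr ltrDl.
  by rewrite in_itv /= => /andP[_]; exists q.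
have sizeE z i : (i < size z)%N <-> exists q, below z (i, q).
  split=> [iz|[q /andP[]]//].
  by have [q qz] := rat_below z`_i; exists q; rewrite /below iz.
have size_le z z' : below z =1 below z' -> (size z <= size z')%N.
  move=> zz'; rewrite leqNgt; apply/negP => /sizeE[q]; rewrite zz' => /andP[].
  by rewrite ltnn.
have exy : size x = size y.
  by apply/eqP; rewrite eqn_leq !size_le // => q; rewrite belowE.
have le_nth z z' i : below z =1 below z' -> (i < size z)%N -> z`_i <= z'`_i.
  move=> zz' iz; rewrite leNgt; apply/negP => /rat_in_itvoo[q].
  rewrite in_itv /= => /andP[q1 q2]; have := zz' (i, q).
  by rewrite /below /= iz q2 /= (ltNge (ratr q)) (ltW q1) andbF.
apply: (@eq_from_nth _ 0) => // i ix; apply/eqP.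
by rewrite eq_le !le_nth -?exy // => q; rewrite belowE.
Qed.

(** Base 4 expansions with digits 0 and 1: the tail after [n] digits is at most [4^-1 ^+ n / 3], too
    small to make up for a smaller digit, so the sums respect the lexicographic order. *)
Lemma cantor_interval : exists e : (nat -> bool) -> R,
  injective e /\ forall b, 1 / 2 < e b < 1.
Proof.
pose S b n : R := \sum_(i < n) (b i)%:R * 4^-1 ^+ i.+1.
have q4 n : 0 < 4^-1 ^+ n :> R by apply: exprn_gt0; rewrite invr_gt0.
have Sle b n k : S b (n + k)%N <= S b n + (4^-1 ^+ n - 4^-1 ^+ (n + k)) / 3.
  elim: k => [|k IH]; first by rewrite addn0 subrr mul0r addr0.
  rewrite addnS {1}/S big_ord_recr /= -/(S b _) exprS.
  have := q4 (n + k)%N; move: (4^-1 ^+ (n + k)) IH => q.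
  by case: (b _) => /=; lra.
have Sge b n k : S b n <= S b (n + k)%N.
  elim: k => [|k IH]; first by rewrite addn0.
  rewrite addnS; apply: le_trans IH _.
  by rewrite [leRHS]big_ord_recr lerDl mulr_ge0 ?ler0n // ltW.
have Sub b n m : S b m <= S b n + 4^-1 ^+ n / 3.
  have [/subnKC nm|/ltnW/subnKC mn] := leqP n m.
    by have := Sle b n (m - n)%N; have := q4 (n + (m - n))%N; rewrite nm; lra.
  by have := Sge b m (n - m)%N; have := q4 n; rewrite mn; lra.
pose e b := sup (range (S b)).
have Sup b : has_sup (range (S b)).
  split; first by exists (S b 0%N), 0%N.
  by exists (S b 0%N + 4^-1 ^+ 0 / 3) => _ [m _ <-].
have e_ge b n : S b n <= e b.
  by apply: ub_le_sup; [have [] := Sup b | exists n].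
have e_le b n : e b <= S b n + 4^-1 ^+ n / 3.
  by apply: ge_sup => [|_ [m _ <-]//]; have [] := Sup b.
have e_lt b b' n : (forall i, (i < n)%N -> b i = b' i) -> ~~ b n -> b' n ->
    e b < e b'.
  move=> bb' nb nb'; have := e_le b n.+1; have := e_ge b' n.+1.
  rewrite /S !big_ord_recr /= (negbTE nb) nb' mul0r mul1r.
  rewrite (eq_bigr (fun i : 'I_n => (b i)%:R * 4^-1 ^+ i.+1)) => [|i _].
    by have := q4 n.+1; lra.
  by rewrite bb'.
(* The sums lie in [0, 1/3]; the shift moves them strictly between 1/2 and 1. *)
exists (fun b => 11 / 20 + e b); split=> [b b' /addrI ebb'|b]; last first.
  by have := e_ge b 0%N; have := e_le b 0%N; rewrite /S big_ord0 expr0; lra.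
apply/funext => n; elim/ltn_ind: n => n IH.
case bn: (b n); case b'n: (b' n) => //.
  suff : e b' < e b by rewrite ebb' ltxx.
  by apply: (@e_lt _ _ n); rewrite ?bn ?b'n // => i /IH.

suff : e b < e b' by rewrite ebb' ltxx.
by apply: (@e_lt _ _ n); rewrite ?bn ?b'n // => i /IH.

Qed.

End Continuum.

(** * Greedy expansions in signed powers of a real *)

Section Greedy.
Variable R : realType.
Implicit Types (c y u : R) (l : seq int).

(** Since [Num.sg 0 = 0], a residue that reaches 0 stays 0. *)
Fixpoint residue c y n : R :=
  if n is m.+1 then residue c y m - Num.sg (residue c y m) * c ^+ m else y.

Definition int_poly l : {poly R} := Poly [seq i%:~R | i <- l].

Definition digits c y n : seq int := mkseq (fun i => sgz (residue c y i)) n.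

Lemma horner_int_poly l c :
  (int_poly l).[c] = \sum_(i < size l) (nth 0 l i)%:~R * c ^+ i.
Proof.
rewrite (@horner_coef_wide _ (size l)); last first.
  by apply: leq_trans (size_Poly _) _; rewrite size_map.
by apply: eq_bigr => i _; rewrite coef_Poly (nth_map 0).
Qed.

Lemma residueE c y n : residue c y n = y - (int_poly (digits c y n)).[c].
Proof.
rewrite horner_int_poly size_mkseq; elim: n => [|n IH] /=.
  by rewrite big_ord0 subr0.
rewrite big_ord_recr opprD addrA {1}IH nth_mkseq //= -sgrEz; congr (_ - _ - _).
by apply: eq_bigr => i _; rewrite !nth_mkseq // ltnW // ltnS.
Qed.

(** The last digit is nonzero, so [Poly] trims nothing. *)
Lemma size_int_poly_digits c y n : residue c y n.-1 != 0 ->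
  size (int_poly (digits c y n)) = n.
Proof.
case: n => [|n] un; first by rewrite size_poly0.
rewrite (@PolyK _ 0) ?size_map ?size_iota //.
by rewrite -nth_last size_map size_mkseq (nth_map 0) ?size_mkseq // nth_mkseq //=
  intr_eq0 sgz_eq0.
Qed.

(** The bound is the tail sum c^n/(1-c). A step without overshoot removes c^n from it and leaves
    c^(n+1)/(1-c); an overshoot is at most c^n, which is smaller still because c > 1/2. *)
Lemma residue_bound c y n : 1 / 2 < c < 1 -> 0 < y < 1 ->
  `|residue c y n| * (1 - c) <= c ^+ n.
Proof.
move=> c_bnd y01; elim: n => [|n IH] /=.
  by rewrite expr0 ger0_norm; nra.
have cn : 0 < c ^+ n by apply: exprn_gt0; lra.
rewrite exprS; move: (residue c y n) (c ^+ n) IH cn => u w IH w0.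
case: (sgrP u) IH => [->|u0|u0] IH; first by rewrite mul0r subr0 normr0; nra.
- by case: (ger0P (u - 1 * w)) => ?; nra.
- by case: (ger0P (u - -1 * w)) => ?; nra.
Qed.

Lemma residue_small c y d : 1 / 2 < c < 1 -> 0 < y < 1 -> 0 < d ->
  exists n, `|residue c y n| < d.
Proof.
move=> c_bnd y01 d0; have e0 : 0 < 1 - c by lra.
have cX n : 0 < c ^+ n by apply: exprn_gt0; lra.
have bernoulli n : c ^+ n * (1 + n%:R * (1 - c)) <= 1.
  elim: n => [|n IH]; first by rewrite expr0 mul0r; lra.
  rewrite exprS -natr1; have := cX n; have := ler0n R n.
  move: (c ^+ n) (n%:R) IH => q m IH m0 q0.
  have : 0 <= q * (m + 1) * (1 - c) ^+ 2 by rewrite !mulr_ge0 ?exprn_ge0; lra.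
  by lra.
(* For this [n], n d (1-c)^2 > 1, so the Bernoulli bound gives c^n < d(1-c). *)
pose n := Num.bound (d * (1 - c) ^+ 2)^-1; exists n.
have de0 : 0 < d * (1 - c) ^+ 2 by rewrite mulr_gt0 ?exprn_gt0.
have : (d * (1 - c) ^+ 2)^-1 < n%:R by apply: archi_boundP; rewrite invr_ge0 ltW.
rewrite -[ltLHS]mul1r ltr_pdivrMr // => n_lt.
have n0 : 0 < n%:R :> R by rewrite -(pmulr_lgt0 _ de0); lra.
have cn : c ^+ n < d * (1 - c).
  rewrite -(ltr_pM2l (mulr_gt0 n0 e0)); have := bernoulli n; have := cX n; lra.
by rewrite -(ltr_pM2r e0); apply: le_lt_trans cn; apply: residue_bound.
Qed.

(* The greedy expansion of y stops at any step N at which the residue reaches a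
   new strict minimum in absolute value: up to N, the partial sum has the same
   greedy digits as y. *)
Lemma residue_digits c y N :
  (forall n, (n < N)%N -> `|residue c y N| < `|residue c y n|) ->
  residue c (int_poly (digits c y N)).[c] N = 0.
Proof.
move=> min; have -> : (int_poly (digits c y N)).[c] = y - residue c y N.
  by rewrite residueE opprB addrC subrK.
suff shift n : (n <= N)%N ->
    residue c (y - residue c y N) n = residue c y n - residue c y N.
  by rewrite shift // subrr.
elim: n => [//|n IH] nN /=; rewrite IH 1?ltnW //.
(* The residue at [N] is smaller in absolute value, so subtracting it preserves the sign. *)
suff -> : Num.sg (residue c y n - residue c y N) = Num.sg (residue c y n).
  by rewrite addrAC.
have := min n nN; move: (residue c y N) (residue c y n) => v u.
case: (sgrP u) => [->|u0|u0]; first by rewrite ltNge normr_ge0.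
- by rewrite ltr_norml => vu; rewrite gtr0_sg //; lra.
- by rewrite ltr_norml => vu; rewrite ltr0_sg //; lra.
Qed.

(** Take [e <= d] below the first [m] residues and stop at the first residue smaller than [e]. It is
    a new strict minimum, reached no earlier than step [m]. *)
Lemma greedy_approx c y d m : 1 / 2 < c < 1 -> 0 < y < 1 -> 0 < d ->
    (forall n, residue c y n != 0) ->
  exists l, [/\ (m <= size (int_poly l))%N, `|(int_poly l).[c] - y| < d
    & exists n, residue c (int_poly l).[c] n = 0].
Proof.
move=> c_bnd y01 d0 un0.
have [e e0 [ed em]] : exists2 e, 0 < e &
    e <= d /\ forall n, (n < m)%N -> e <= `|residue c y n|.
  elim: m => [|m [e e0 [ed em]]]; first by exists d.
  exists (Num.min e `|residue c y m|).
    by rewrite lt_min e0 normr_gt0 un0.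
  split=> [|n]; first by rewrite ge_min ed.
  rewrite ltnS leq_eqVlt => /predU1P[->|nm]; first by rewrite ge_min lexx orbT.
  by rewrite ge_min em.
have small : exists n, `|residue c y n| < e by apply: residue_small.
have uN : `|residue c y (ex_minn small)| < e by case: ex_minnP.
have minN n : `|residue c y n| < e -> (ex_minn small <= n)%N.
  by case: ex_minnP => N _; apply.
move: (ex_minn small) uN minN => N uN minN.
exists (digits c y N); split.
- rewrite size_int_poly_digits //; rewrite leqNgt; apply/negP => /em.
  by rewrite leNgt uN.
- rewrite distrC -residueE; exact: lt_le_trans ed.
- exists N; apply: residue_digits => n nN; apply: lt_le_trans uN _.
  by rewrite leNgt; apply/negP => /minN; rewrite leqNgt nN.
Qed.

End Greedy.

(** * The spiral program *)

Section Spiral.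
Variable R : realType.
Implicit Types (c y : R) (p q : program R) (x : seq R) (t : int -> R).

(* Cell 0 holds c, cell 1 the residue, cell 2 the current power of c; both
   branches of the loop take four steps. *)
Definition spiral : program R :=
  [:: IConst 2 1; IBranch 1 8 2 5;
      IAdd 1 1 2; IMul 2 2 0; IBranch 2 1 1 1;
      ISub 1 1 2; IMul 2 2 0; IBranch 2 1 1 1].

Lemma spiral_loop c y n : (forall i, (i < n)%N -> residue c y i != 0) ->
  exists t, [/\ iter (4 * n).+1 (step spiral) (Config 0 (load [:: c; y]))
                = Config 1 t,
                t 0 = c, t 1 = residue c y n & t 2 = c ^+ n].
Proof.
elim: n => [_|n IH un0].
  by eexists; split; first by rewrite /= /step /=.
have {IH}[i /ltnW/un0//|t [eqt t0 t1 t2]] := IH.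
have -> : (4 * n.+1).+1 = (4 + (4 * n).+1)%N by lia.
rewrite iterD eqt; have := un0 n (ltnSn n).
case: (ltrgt0P (residue c y n)) => [u0|u0|//] _.
- rewrite /= {4}/step /= t1 gt_eqF // ltNge (ltW u0) /= /step /= !if_same.
  eexists; split; first by [].
  + by rewrite /= t0.
  + by rewrite /= t1 t2 gtr0_sg // mul1r.
  + by rewrite /= t2 t0 exprSr.
- rewrite /= {4}/step /= t1 lt_eqF // u0 /= /step /= !if_same.
  eexists; split; first by [].
  + by rewrite /= t0.
  + by rewrite /= t1 t2 ltr0_sg // mulN1r opprK.
  + by rewrite /= t2 t0 exprSr.
Qed.

Lemma step_halted p (C : config R) n : (size p <= pc C)%N ->
  iter n (step p) C = C.
Proof. by move=> pC; elim: n => //= n ->; rewrite /step onth_default. Qed.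

Lemma spiral_halts c y n : residue c y n = 0 -> halts spiral [:: c; y].
Proof.
move=> un; have ex_n : exists n, residue c y n == 0 by exists n; apply/eqP.
case: (ex_minnP ex_n) => {un}n /eqP un n_min.
have [i i_n|t [eqt _ t1 _]] := @spiral_loop c y n.
  by apply/negP => /n_min; rewrite leqNgt i_n.
by exists (4 * n).+2; rewrite iterS eqt /step /= t1 un eqxx.
Qed.

Lemma spiral_diverges c y : (forall n, residue c y n != 0) ->
  ~ halts spiral [:: c; y].
Proof.
move=> un0 [n halted]; have [//|t [eqt _ _ _]] := @spiral_loop c y n.
(* A halted configuration is frozen, yet at time 4n+1 >= n the counter is back at 1. *)
have /subnKC ek : (n <= (4 * n).+1)%N by lia.
by move: eqt; rewrite -ek addnC iterD step_halted // => eqt; rewrite eqt in halted.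
Qed.

(** * Unique decoding of programs *)

Definition opcode (i : instr R) : nat := match i with
  | IConst _ _ => 0 | IZero _ => 1 | ICopy _ _ => 2 | IAdd _ _ _ => 3
  | ISub _ _ _ => 4 | IMul _ _ _ => 5 | IDiv _ _ _ => 6 | IShiftL => 7
  | IShiftR => 8 | IBranch _ _ _ _ => 9 end.

Lemma code_instrE i : code_instr i = (opcode i)%:R :: behead (code_instr i).
Proof. by case: i. Qed.

Lemma code_instr_prefix i j (s s' : seq R) :
  code_instr i ++ s = code_instr j ++ s' -> i = j /\ s = s'.
Proof.
rewrite code_instrE [code_instr j]code_instrE /= => -[/eqP].
rewrite eqr_nat => /eqP; case: i; case: j => //=.
- by move=> i a j b _ [/intr_inj-> -> ->].
- by move=> i j _ [/intr_inj-> ->].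
- by move=> i j k l _ [/intr_inj-> /intr_inj-> ->].
- by move=> i j k l m n _ [/intr_inj-> /intr_inj-> /intr_inj-> ->].
- by move=> i j k l m n _ [/intr_inj-> /intr_inj-> /intr_inj-> ->].
- by move=> i j k l m n _ [/intr_inj-> /intr_inj-> /intr_inj-> ->].
- by move=> i j k l m n _ [/intr_inj-> /intr_inj-> /intr_inj-> ->].
- move=> i a b d j a' b' d' _ [/intr_inj-> /eqP ea /eqP eb /eqP ed ->].
  by move: ea eb ed; rewrite !eqr_nat => /eqP-> /eqP-> /eqP->.
Qed.

Lemma code_inj : injective (@code R).
Proof.
elim=> [|i p IH] [|j q] //; first by rewrite /code /= (code_instrE j).
  by rewrite /code /= (code_instrE i).
by move=> /code_instr_prefix[-> /IH->].
Qed.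

Lemma tuple_pair_code_inj p q x (y : seq R) :
  tuple_pair (code p) x = tuple_pair (code q) y ->
  p = q /\ x = y.
Proof.
case=> /eqP; rewrite eqr_nat => /eqP size_pq epq.
have /eqP := epq; rewrite eqseq_cat // => /andP[/eqP/code_inj-> /eqP->].
by [].
Qed.

Lemma mem_halting_problem p x :
  halting_problem R (tuple_pair (code p) x) <-> halts p x.
Proof.
split=> [[q [y [/tuple_pair_code_inj[-> ->]]]]//|px].
by exists p, x.
Qed.

End Spiral.

(** * Rational functions of two variables *)

Section Rational.
Variable R : realType.
Implicit Types (p q g : {poly R}) (P Q : {poly {poly R}}) (F G : R -> R -> R).

Lemma countable_root p : p != 0 -> countable [set x | root p x].
Proof.
move=> p0; apply/finite_set_countable/(sub_finite_set _ (finite_seq (rootsR p))).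
by move=> x px; rewrite /= -(roots_on_rootsR p0) in_itv.
Qed.

(* Polynomials in X and Y are polynomials in Y over R[X]; c is substituted for
   X. *)
Definition subst c P : {poly R} := map_poly (horner_eval c) P.

Lemma subst_horner c P g : (P.[g]).[c] = (subst c P).[g.[c]].
Proof. by rewrite -[LHS]/(horner_eval c _) -horner_map. Qed.

(** Such a [c] is a root of the leading coefficient of [P]. *)
Lemma countable_subst0 P : P != 0 -> countable [set c | subst c P = 0].
Proof.
rewrite -lead_coef_eq0 => /countable_root; apply: sub_countable.
apply: subset_card_le => c /= cP0.
have : (subst c P)`_(size P).-1 = 0 by rewrite cP0 coef0.
by rewrite coef_map /= => /eqP.
Qed.

(** In Horner's scheme, once [P.[g]] is nonzero, [P.[g] * g] has degree at least that of [g], hence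
    above that of the next coefficient, and cannot cancel it. *)
Lemma horner_neq0 P g :
  P != 0 -> (forall i, (size (P`_i)%R < size g)%N) -> P.[g] != 0.
Proof.
elim/poly_ind: P => [|P p IH]; first by rewrite eqxx.
rewrite hornerMXaddC => Pp0 Pg; have := Pg 0%N.
rewrite coefD coefMX coefC /= add0r => pg.
have [P0|P0] := eqVneq P 0.
  by move: Pp0; rewrite P0 mul0r horner0 mul0r !add0r polyC_eq0.
have {}P0 : P.[g] != 0.
  by apply: IH => // i; have := Pg i.+1; rewrite coefD coefMX coefC /= addr0.
have g0 : g != 0 by rewrite -size_poly_gt0; case: (size g) pg.
have Pg_size : (size p < size (P.[g] * g)%R)%N.
  apply: leq_trans pg _; rewrite size_mul //; move: P0; rewrite -size_poly_gt0.
  by case: (size P.[g]) => // k _; rewrite addSn leq_addl.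
apply/eqP => /(congr1 (fun q => size q)); rewrite size_polyDl // size_poly0.
by lia.
Qed.

(** Nothing is required at zeros of the denominator; [regular] and [fresh] avoid them later. *)
Definition rational F := exists PQ : {poly {poly R}} * {poly {poly R}},
  PQ.2 != 0 /\ forall c y, (subst c PQ.2).[y] != 0 ->
    F c y = (subst c PQ.1).[y] / (subst c PQ.2).[y].

Lemma rational_poly P : rational (fun c y => (subst c P).[y]).
Proof.
exists (P, 1); split=> [|c y _]; first exact: oner_neq0.
by rewrite /subst rmorph1 hornerE divr1.
Qed.

Lemma rational_const a : rational (fun _ _ => a).
Proof.
have [PQ [Q0 E]] := rational_poly (a%:P)%:P; exists PQ; split=> // c y /E <-.
by rewrite /subst map_polyC hornerC /= /horner_eval hornerC.
Qed.

Lemma rational_fst : rational (fun c _ => c).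
Proof.
have [PQ [Q0 E]] := rational_poly ('X%:P); exists PQ; split=> // c y /E <-.
by rewrite /subst map_polyC hornerC /= /horner_eval hornerX.
Qed.

Lemma rational_snd : rational (fun _ y => y).
Proof.
have [PQ [Q0 E]] := rational_poly 'X; exists PQ; split=> // c y /E <-.
by rewrite /subst map_polyX hornerX.
Qed.

Lemma rational_add F G :
  rational F -> rational G -> rational (fun c y => F c y + G c y).
Proof.
move=> [[P Q] /= [Q0 FE]] [[P' Q'] /= [Q'0 GE]].
exists (P * Q' + P' * Q, Q * Q') => /=; split; first by rewrite mulf_neq0.
move=> c y; rewrite /subst !rmorphM !rmorphD !rmorphM /= !hornerE mulf_eq0.
by case/norP=> Qcy Q'cy; rewrite FE // GE // addf_div.
Qed.

Lemma rational_mul F G :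
  rational F -> rational G -> rational (fun c y => F c y * G c y).
Proof.
move=> [[P Q] /= [Q0 FE]] [[P' Q'] /= [Q'0 GE]].
exists (P * P', Q * Q') => /=; split; first by rewrite mulf_neq0.
move=> c y; rewrite /subst !rmorphM /= !hornerE mulf_eq0.
by case/norP=> Qcy Q'cy; rewrite FE // GE // mulf_div.
Qed.

Lemma rational_sub F G :
  rational F -> rational G -> rational (fun c y => F c y - G c y).
Proof.
move=> rF rG; have := rational_add rF (rational_mul (rational_const (-1)) rG).
by move=> [PQ [Q0 E]]; exists PQ; split=> // c y /E <-; rewrite mulN1r.
Qed.

(* The divisor may vanish identically, in which case the quotient is never
   evaluated. *)
Lemma rational_div F G H : rational F -> rational G -> rational H ->
  rational (fun c y => if G c y == 0 then H c y else F c y / G c y).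
Proof.
move=> [[P Q] /= [Q0 FE]] [[P' Q'] /= [Q'0 GE]] [[S T] /= [T0 HE]].
have [P'0|P'0] := eqVneq P' 0.
  exists (S * Q', T * Q') => /=; split; first by rewrite mulf_neq0.
  move=> c y; rewrite /subst !rmorphM /= !hornerE mulf_eq0.
  case/norP=> Tcy Q'cy; rewrite GE // P'0 /subst rmorph0 horner0 mul0r eqxx HE //.
  by rewrite -mulf_div divff // mulr1.
exists (P * Q' * Q', Q * Q' * P') => /=; split; first by rewrite !mulf_neq0.
move=> c y; rewrite /subst !rmorphM /= !hornerE !mulf_eq0 !negb_or.
case/andP=> /andP[Qcy Q'cy] P'cy; rewrite FE // GE // mulf_eq0 invr_eq0.
rewrite (negbTE P'cy) (negbTE Q'cy) /=; field.
by rewrite Qcy Q'cy P'cy.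
Qed.

End Rational.

(** * Computation paths of the oracle machine *)

Section Oracle.
Variables (R : realType) (M : oprogram R) (C : set (seq R)).
Implicit Types (c y : R) (l : seq int) (i : int) (path : seq nat).

Definition input c y : seq R := tuple_pair (code (spiral R)) [:: c; y].

Definition conf c y k : config R :=
  iter k (ostep C M) (Config 0 (load (input c y))).

Definition trace c y k : seq nat := mkseq (fun j => pc (conf c y j)) k.

(* The tape after executing the instructions at the given addresses one after
   the other, whatever the outcome of the tests. *)
Definition run path c y : int -> R :=
  foldl (fun t n => tape (ostep C M (Config n t))) (load (input c y)) path.

Lemma run_rcons path n c y :
  run (rcons path n) c y = tape (ostep C M (Config n (run path c y))).
Proof. by rewrite /run foldl_rcons. Qed.

Lemma traceS c y k : trace c y k.+1 = rcons (trace c y k) (pc (conf c y k)).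
Proof. by rewrite /trace mkseqS. Qed.

Lemma trace_inj c y c' y' k : trace c y k.+1 = trace c' y' k.+1 ->
  trace c y k = trace c' y' k /\ pc (conf c y k) = pc (conf c' y' k).
Proof. by rewrite !traceS => /rcons_inj[]. Qed.

Lemma confE c y k :
  conf c y k = Config (pc (conf c y k)) (run (trace c y k) c y).
Proof.
suff <- : tape (conf c y k) = run (trace c y k) c y by case: (conf c y k).
elim: k => [//|k IH]; rewrite traceS run_rcons -IH.
by rewrite /conf iterS -/(conf c y k); case: (conf c y k).
Qed.

Lemma size_input c y : size (input c y) = (size (code (spiral R))).+3.
Proof. by rewrite /input /tuple_pair -cat1s !size_cat addn2. Qed.

Lemma rational_load i : rational (fun c y => load (input c y) i).
Proof.
case: i => k; last first.
  have -> : (fun c y => load (input c y) (Negz k)) =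
      fun _ _ => (k < (size (code (spiral R))).+3)%N%:R.
    by apply/funext => c; apply/funext => y; rewrite /load size_input.
  exact: rational_const.
case: k => [|k]; first exact: rational_const.
rewrite /load /input /tuple_pair; set s := code (spiral R).
have [k_lt|k_ge] := ltnP k (size s).
  have -> : (fun c y => (s ++ [:: c; y])`_k) = fun _ _ => s`_k.
    by apply/funext => c; apply/funext => y; rewrite nth_cat k_lt.
  exact: rational_const.
have -> : (fun c y => (s ++ [:: c; y])`_k) = fun c y => [:: c; y]`_(k - size s).
  by apply/funext => c; apply/funext => y; rewrite nth_cat ltnNge k_ge.
case: (k - size s)%N => [|[|n]] /=; first exact: rational_fst.
  exact: rational_snd.
by rewrite nth_nil; apply: rational_const.
Qed.

Lemma rational_run path i : rational (fun c y => run path c y i).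
Proof.
elim/last_ind: path i => [|path n IH] i; first exact: rational_load.
have -> : (fun c y => run (rcons path n) c y i) =
    fun c y => tape (ostep C M (Config n (run path c y))) i.
  by apply/funext => c; apply/funext => y; rewrite run_rcons.
rewrite /ostep /=; case: (onth M n) => [[ins|??]|] //=.
have set_cell j F : rational F ->
    rational (fun c y => [eta run path c y with j |-> F c y] i).
  by move=> rF /=; case: eqP.
case: ins => [j a|j|j k|j k m|j k m|j k m|j k m|||????] //=.
- by apply: set_cell; apply: rational_const.
- by apply: set_cell; apply: rational_const.
- exact: set_cell.
- by apply: set_cell; apply: rational_add.
- by apply: set_cell; apply: rational_sub.
- by apply: set_cell; apply: rational_mul.
(* A division by zero leaves the tape unchanged, so the target cell keeps its old value. *)
- have -> : (fun c y => tape (if run path c y m == 0 then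
        Config n (run path c y) else Config n.+1
        [eta run path c y with j |-> run path c y k / run path c y m]) i) =
      fun c y => if i == j then if run path c y m == 0 then run path c y j
        else run path c y k / run path c y m else run path c y i.
    apply/funext => c; apply/funext => y; case: ifP => _ /=; last by [].
    by case: eqP => // ->.
  case: eqP => // _; exact: rational_div.
Qed.

(** A step shifts by one cell or writes at one fixed address. The bound ensures that the block of 1s
    giving the length of a queried tuple ends. *)
Lemma run_left0 path :
  exists B, forall c y k, (B <= k)%N -> run path c y (Negz k) = 0.
Proof.
elim/last_ind: path => [|path n [B run0]].
  by exists (size (code (spiral R))).+3 => c y k Bk; rewrite /run [LHS]/load
    size_input ltnNge Bk.
suff [B' tape0] : exists B', forall t, (forall k, (B <= k)%N -> t (Negz k) = 0) ->
    forall k, (B' <= k)%N -> tape (ostep C M (Config n t)) (Negz k) = 0.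
  by exists B' => c y k B'k; rewrite run_rcons tape0 // => m; apply: run0.
rewrite /ostep /=; case: (onth M n) => [[ins|??]|] /=; try by exists B.
have set_cell (i : int) : exists B', forall t,
    (forall k, (B <= k)%N -> t (Negz k) = 0) ->
    forall v : R, forall k, (B' <= k)%N -> [eta t with i |-> v] (Negz k) = 0.
  exists (B + `|i|).+1 => t t0 v k Bk /=; case: eqP => [e|_]; first by lia.
  by apply: t0; lia.
case: ins => [j a|j|j k|j k m|j k m|j k m|j k m|||????] /=; try by exists B.
all: try by have [B' B'P] := set_cell j; exists B' => t t0 k' /(B'P t t0); apply.
- have [B' B'P] := set_cell j; exists (B + B')%N => t t0 k' Bk; case: eqP => _ /=.
    by apply: t0; lia.
  by apply: (B'P t t0); lia.
- by exists B.+1 => t t0 [//|k] Bk; rewrite (_ : _ + 1 = Negz k) ?t0 //; lia.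
- by exists B => t t0 k Bk; rewrite (_ : _ - 1 = Negz k.+1) ?t0 //; lia.
Qed.

Definition cell path i := projT1 (cid (rational_run path i)).
Definition num path i := (cell path i).1.
Definition den path i := (cell path i).2.

Lemma den_neq0 path i : den path i != 0.
Proof. by rewrite /den /cell; case: cid => PQ []. Qed.

Lemma run_rational path i c y : (subst c (den path i)).[y] != 0 ->
  run path c y i = (subst c (num path i)).[y] / (subst c (den path i)).[y].
Proof. by rewrite /num /den /cell; case: cid => PQ [_ E] /= /E. Qed.

Definition regular c := forall path i, subst c (den path i) != 0.

Lemma countable_irregular : countable [set c | ~ regular c].
Proof.
pose Z (d : seq nat * int) := [set c | subst c (den d.1 d.2) = 0].
apply: (@sub_countable _ _ _ (\bigcup_(d in setT) Z d)).
  apply: subset_card_le => c /existsNP[path /existsNP[i /negP]].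
  by rewrite negbK => /eqP ci; exists (path, i).
apply: bigcup_countable => // d _; exact: countable_subst0 (den_neq0 _ _).
Qed.

(** The value b = 0 serves zero and sign tests, b = 1 the unary length marks; the last clause makes
    the spiral diverge. *)
Definition fresh c y := [/\ forall path i, (subst c (den path i)).[y] != 0,
  forall path i (b : bool),
    subst c (num path i) - b%:R *: subst c (den path i) != 0 ->
    (subst c (num path i) - b%:R *: subst c (den path i)).[y] != 0
  & forall l, (int_poly R l).[c] != y].

Lemma countable_stale c : regular c -> countable [set y | ~ fresh c y].
Proof.
move=> reg.
pose Z (d : seq nat * int * bool + seq nat * int + seq int) := match d with
  | inl (inl (path, i, b)) => [set y |
      subst c (num path i) - b%:R *: subst c (den path i) != 0 /\
      root (subst c (num path i) - b%:R *: subst c (den path i)) y]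
  | inl (inr (path, i)) => [set y | root (subst c (den path i)) y]
  | inr l => [set (int_poly R l).[c]]
  end.
apply: (@sub_countable _ _ _ (\bigcup_(d in setT) Z d)).
  apply: subset_card_le => y; apply: contra_notP => nZ.
  split=> [path i|path i b W0|l]; apply/negP => /eqP y0; apply: nZ.
  - by exists (inl (inr (path, i))) => //=; apply/eqP.
  - by exists (inl (inl (path, i, b))) => //=; split=> //; apply/eqP.
  - by exists (inr l).
apply: bigcup_countable => // -[[[[path i] b]|[path i]]|l] _ /=.
- have [->|W0] := eqVneq (subst c (num path i) - b%:R *: subst c (den path i)) 0.
    by apply: sub_countable (countable0 R); apply: subset_card_le => y [].
  apply: sub_countable (countable_root W0); apply: subset_card_le => y [_].
  by [].
- exact: countable_root.
- exact: countable1.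
Qed.

(** * Stability of paths near a fresh point *)

(* The points (int_poly l).[c] close to y and given by polynomials of large
   degree. *)
Definition near_polys c y (Phi : seq int -> Prop) := exists m d, 0 < d /\
  forall l, (m <= size (int_poly R l))%N -> `|(int_poly R l).[c] - y| < d ->
    Phi l.

Lemma near_all c y Phi : (forall l, Phi l) -> near_polys c y Phi.
Proof. by move=> all; exists 0%N, 1; split. Qed.

Lemma near_and c y Phi Psi : near_polys c y Phi -> near_polys c y Psi ->
  near_polys c y (fun l => Phi l /\ Psi l).
Proof.
move=> [m [d [d0 P]]] [m' [d' [d'0 P']]]; exists (maxn m m'), (Num.min d d').
split=> [|l]; first by rewrite lt_min d0.
by rewrite geq_max lt_min => /andP[? ?] /andP[? ?]; split; [apply: P|apply: P'].
Qed.

Lemma near_mono c y (Phi Psi : seq int -> Prop) : (forall l, Phi l -> Psi l) ->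
  near_polys c y Phi -> near_polys c y Psi.
Proof.
by move=> PhiPsi [m [d [d0 P]]]; exists m, d; split=> // l /P/[apply]/PhiPsi.
Qed.

Lemma near_forall_lt c y n (Phi : nat -> seq int -> Prop) :
  (forall j, (j < n)%N -> near_polys c y (Phi j)) ->
  near_polys c y (fun l => forall j, (j < n)%N -> Phi j l).
Proof.
elim: n => [_|n IH near]; first exact: near_all.
have := near_and (IH (fun j jn => near j (ltnW jn))) (near n (ltnSn n)).
by apply: near_mono => l [lt_n eq_n] j; rewrite ltnS leq_eqVlt => /predU1P[->|/lt_n].
Qed.

Lemma near_size c y m : near_polys c y (fun l => (m <= size (int_poly R l))%N).
Proof. by exists m, 1; split. Qed.

Lemma near_horner c y (p : {poly R}) : p.[y] != 0 ->
  near_polys c y (fun l => Num.sg p.[(int_poly R l).[c]] = Num.sg p.[y]).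
Proof.
rewrite -normr_gt0 => /(poly_cont y p)[d d0 dP]; exists 0%N, d; split=> // l _ /dP.
move: p.[_] p.[y] => u v; case: (ltrgt0P v) => [v0|v0|_]; last by
  rewrite ltNge normr_ge0.
- by rewrite ltr_norml => uv; rewrite (gtr0_sg v0) gtr0_sg //; lra.
- by rewrite ltr_norml => uv; rewrite (ltr0_sg v0) ltr0_sg //; lra.
Qed.

Definition constant_cell c path i :=
  exists v, subst c (num path i) = v *: subst c (den path i).

Definition coef_size (P : {poly {poly R}}) := \max_(i < size P) size (P`_i)%R.

Lemma leq_coef_size (P : {poly {poly R}}) (i : nat) :
  (size (P`_i)%R <= coef_size P)%N.
Proof.
have [iP|Pi] := ltnP i (size P).
  exact: (@leq_bigmax _ (fun i : 'I_(size P) => size (P`_i)%R) (Ordinal iP)).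
by rewrite nth_default // size_poly0.
Qed.

Section FreshPoint.
Variables c y : R.
Hypothesis y_fresh : fresh c y.

Let pt l := (int_poly R l).[c].

Lemma near_den path i :
  near_polys c y (fun l => (subst c (den path i)).[pt l] != 0).
Proof.
have [den0 _ _] := y_fresh; have := near_horner c (den0 path i).
by apply: near_mono => l sg_l; rewrite -sgr_eq0 sg_l sgr_eq0.
Qed.

Lemma run_subE path i (b : bool) z : (subst c (den path i)).[z] != 0 ->
  run path c z i - b%:R =
  (subst c (num path i) - b%:R *: subst c (den path i)).[z]
    / (subst c (den path i)).[z].
Proof. by move=> den0; rewrite run_rational // !hornerE; field. Qed.

(** The numerator of the difference either vanishes identically in [y] or is nonzero at the fresh
    [y]; in the latter case signs persist by continuity. *)
Lemma near_sign path i (b : bool) : near_polys c y (fun l =>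
  Num.sg (run path c (pt l) i - b%:R) = Num.sg (run path c y i - b%:R)).
Proof.
have [den0 num0 _] := y_fresh.
have [W0|W0] := eqVneq (subst c (num path i) - b%:R *: subst c (den path i)) 0.
  apply: near_mono (near_den path i) => l denl.
  by rewrite !run_subE // W0 !horner0 !mul0r.
have := near_and (near_den path i)
  (near_and (near_horner c (den0 path i)) (near_horner c (num0 path i b W0))).
apply: near_mono => l [denl [sg_den sg_num]].
by rewrite !run_subE // !sgrM !sgrV sg_den sg_num.
Qed.

Lemma near_constant path i : constant_cell c path i ->
  near_polys c y (fun l => run path c (pt l) i = run path c y i).
Proof.
have [den0 _ _] := y_fresh; move=> [v numE].
apply: near_mono (near_den path i) => l denl.
by rewrite !run_rational // numE !hornerZ !mulfK.
Qed.

(* An element of C seen by a query along path whose j-th entry genuinely depends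
   on the input: on y for c fixed in [varies_y], and on c when y = g(c) for a
   polynomial g of large degree in [varies_c]. *)
Definition varies_y c (d : seq nat * nat) y (x : seq R) :=
  [/\ ~ constant_cell c d.1 (Posz d.2), (subst c (den d.1 (Posz d.2))).[y] != 0
    & x`_d.2 = run d.1 c y (Posz d.2)].

Definition varies_c (d : seq nat * nat * seq int) c (x : seq R) :=
  varies_y c d.1 (int_poly R d.2).[c] x /\
  (maxn (coef_size (num d.1.1 (Posz d.1.2))) (coef_size (den d.1.1 (Posz d.1.2)))
    < size (int_poly R d.2))%N.

Section SameAnswers.
Hypothesis no_y : forall d x, C x -> ~ varies_y c d y x.
Hypothesis no_c : forall d x, C x -> ~ varies_c d c x.

Lemma holds_size (t : int -> R) x m : (forall j, (j < m)%N -> t (Negz j) = 1) ->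
  t (Negz m) <> 1 -> holds t x -> size x = m.
Proof.
move=> t1 tm [xt1 xtm _]; case: (ltngtP (size x) m) => // [/t1//|/xt1//].
Qed.

(** The length of the queried tuple persists. If all its entries are constant in [y], the same tuple
    is queried; otherwise [no_y] and [no_c] make both answers negative. *)
Lemma near_query path : near_polys c y (fun l =>
  `[< exists2 x, holds (run path c (pt l)) x & C x >] =
  `[< exists2 x, holds (run path c y) x & C x >]).
Proof.
have [den0 _ _] := y_fresh.
have ex_m : exists m, run path c y (Negz m) != 1.
  have [B run0] := run_left0 path.
  by exists B; rewrite run0 // eq_sym oner_neq0.
case: (ex_minnP ex_m) => m /eqP run_m m_min.
have run1 j : (j < m)%N -> run path c y (Negz j) = 1.
  by move=> jm; apply/eqP; apply: contraTT jm => /m_min; rewrite leqNgt.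
have near_length : near_polys c y (fun l =>
    (forall j, (j < m)%N -> run path c (pt l) (Negz j) = 1) /\
    run path c (pt l) (Negz m) <> 1).
  apply: near_and.
    apply: near_forall_lt => j /run1 run_j.
    apply: near_mono (near_sign path (Negz j) true) => l /eqP.
    by rewrite run_j subrr sgr0 sgr_eq0 subr_eq0 => /eqP.
  apply: near_mono (near_sign path (Negz m) true) => l sg_l run_l.
  move/eqP: sg_l; rewrite run_l subrr sgr0 eq_sym sgr_eq0 subr_eq0 => /eqP.
  exact: run_m.
have [const|/existsNP[j /not_implyP[jm nconst]]] :=
    pselect (forall j, (j < m)%N -> constant_cell c path (Posz j)).
  have := near_and near_length
    (near_forall_lt (fun j jm => near_constant (const j jm))).
  apply: near_mono => l [[l1 lm] lE]; congr asbool; apply/propext.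
  split=> -[x xh Cx]; exists x => //; have [_ _ x_nth] := xh.
    have xm := holds_size l1 lm xh.
    by split; rewrite xm // => k km; rewrite -lE // x_nth // xm.
  have xm := holds_size run1 run_m xh.
  by split; rewrite xm // => k km; rewrite lE // x_nth // xm.
have := near_and near_length (near_and (near_den path (Posz j))
  (near_size c y (maxn (coef_size (num path (Posz j)))
                       (coef_size (den path (Posz j)))).+1)).
apply: near_mono => l [[l1 lm] [denl size_l]].
have no_l : ~ exists2 x, holds (run path c (pt l)) x & C x.
  move=> [x xh Cx]; apply: (no_c (d := (path, j, l)) Cx); split=> //; split=> //=.
  by have [_ _ x_nth] := xh; rewrite x_nth // (holds_size l1 lm xh).
have no_base : ~ exists2 x, holds (run path c y) x & C x.
  move=> [x xh Cx]; apply: (no_y (d := (path, j)) Cx); split=> //=.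
  by have [_ _ x_nth] := xh; rewrite x_nth // (holds_size run1 run_m xh).
by rewrite !asboolF.
Qed.

Lemma near_pc path n : near_polys c y (fun l =>
  pc (ostep C M (Config n (run path c (pt l)))) =
  pc (ostep C M (Config n (run path c y)))).
Proof.
rewrite /ostep /=; case: (onth M n) => [[ins|lyes lno]|] /=; last by apply: near_all.
  case: ins => [??|?|??|???|???|???|i j k|||i leq0 llt0 lgt0] /=;
    try by apply: near_all.
    (* Division is also a test: a zero divisor keeps the counter in place. *)
    apply: near_mono (near_sign path k false) => l; rewrite !subr0 => sg_l.
    by rewrite -sgr_eq0 sg_l sgr_eq0; case: ifP.
  apply: near_mono (near_sign path i false) => l; rewrite !subr0 => sg_l.
  by rewrite -sgr_eq0 -sgr_lt0 sg_l sgr_eq0 sgr_lt0.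
by apply: near_mono (near_query path) => l ->.
Qed.

(** Equal traces put both tapes on the same [run], so [near_pc] compares the next counters. *)
Lemma near_trace k :
  near_polys c y (fun l => trace c (pt l) k.+1 = trace c y k.+1).
Proof.
elim: k => [|k IH]; first by apply: near_all.
have := near_and IH (near_pc (trace c y k) (pc (conf c y k))).
apply: near_mono => l [tr_l pc_l].
rewrite traceS [RHS]traceS tr_l; congr rcons.
have [tr_k pc_k] := trace_inj tr_l.
by rewrite /conf !iterS -!/(conf _ _ k) confE [conf c y k]confE tr_k pc_k.
Qed.

End SameAnswers.
End FreshPoint.

(** * Varying queries and the final count *)

Lemma conf_halted c y k m : (size M <= pc (conf c y k))%N ->
  conf c y (m + k) = conf c y k.
Proof.
move=> halted; elim: m => // m IH.
by rewrite addSn /conf iterS -/(conf c y (m + k)) IH /ostep onth_default.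
Qed.

Lemma conf_halted_eq c y k m : (size M <= pc (conf c y k))%N ->
  (size M <= pc (conf c y m))%N -> conf c y k = conf c y m.
Proof. by move=> kP mP; rewrite -(conf_halted m kP) addnC conf_halted. Qed.

Hypothesis M_correct :
  forall x, ocomputes C M x [:: (x \in halting_problem R)%:R].

Lemma conf_output c y (b : bool) :
  (halting_problem R (input c y) <-> b) ->
  exists k, (size M <= pc (conf c y k))%N /\ tape (conf c y k) 0 = b%:R.
Proof.
move=> inH; have [k [halted [_ _ out]]] := M_correct (input c y).
exists k; split=> //; rewrite /conf (out 0%N) //=; congr ((nat_of_bool _)%:R).
by apply/idP/idP => [/set_mem/inH|/inH/mem_set].
Qed.

(** Otherwise [M] follows the same path at [y] and at a nearby g(c) where the spiral halts, and its
    outputs have equal signs, although they must be 0 and 1. *)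
Lemma query_varies c y : 1 / 2 < c < 1 -> 0 < y < 1 -> fresh c y ->
  (exists d x, C x /\ varies_y c d y x) \/ (exists d x, C x /\ varies_c d c x).
Proof.
move=> c_bnd y01 y_fresh; apply: contrapT => /not_orP[no_y no_c].
have un0 n : residue c y n != 0.
  rewrite residueE subr_eq0 eq_sym; have [_ _] := y_fresh; exact.
have [|k [k_halted k_out]] := @conf_output c y false.
  by split=> // /mem_halting_problem/(spiral_diverges un0).
have near_k := near_trace y_fresh
  (fun d x Cx v => no_y (ex_intro _ d (ex_intro _ x (conj Cx v))))
  (fun d x Cx v => no_c (ex_intro _ d (ex_intro _ x (conj Cx v)))) k.
have [m [d [d0 near_l]]] :=
  near_and near_k (near_sign y_fresh (trace c y k) 0 false).
have [l [/near_l{}near_l /near_l[tr_l sg_l] [n un]]] :=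
  greedy_approx m c_bnd y01 d0 un0.
have [|k' [k'_halted k'_out]] := @conf_output c (int_poly R l).[c] true.
  by split=> // _; apply/mem_halting_problem/spiral_halts/un.
(* The trace of length [k.+1] includes the counter at time [k], so the run at g(c) has halted by
   then too. *)
have [tr_k pc_k] := trace_inj tr_l.
have : tape (conf c (int_poly R l).[c] k) 0 = 1.
  by rewrite (conf_halted_eq _ k'_halted) // pc_k.
rewrite confE /= tr_k => run_l.
rewrite confE /= in k_out; move/eqP: sg_l.
by rewrite run_l k_out !subr0 sgr1 sgr0 oner_eq0.
Qed.

(** Such a [y] is a root of numerator minus x_j times denominator, nonzero because the cell is not
    constant. *)
Lemma countable_varies_y c d x : countable [set y | varies_y c d y x].
Proof.
case: d => path j; have [const|nconst] := pselect (constant_cell c path (Posz j)).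
  by apply: sub_countable (countable0 R); apply: subset_card_le => y [].
have : subst c (num path (Posz j)) - x`_j *: subst c (den path (Posz j)) != 0.
  by apply/eqP => /subr0_eq numE; apply: nconst; exists x`_j.
move=> /countable_root; apply: sub_countable; apply: subset_card_le => y.
move=> [_ /= den0 ->]; rewrite run_rational // /root !hornerE.
by rewrite divfK // subrr.
Qed.

Lemma countable_varies_c d x : countable [set c | varies_c d c x].
Proof.
case: d => [[path j] l].
pose P : {poly {poly R}} :=
  num path (Posz j) - (x`_j)%:P *: den path (Posz j).
have substP c : subst c P =
    subst c (num path (Posz j)) - x`_j *: subst c (den path (Posz j)).
  by rewrite /subst rmorphB /= -mul_polyC rmorphM /= map_polyC /= /horner_eval
    hornerC mul_polyC.
(* One member [c0] of the set suffices to show that [P] is nonzero and that g has large degree, so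
   that [P.[g]] is nonzero. *)
have [-> |/set0P[c0 [[/= nconst _ _] size_l]]] :=
  eqVneq [set c | varies_c (path, j, l) c x] set0; first exact: countable0.
have P0 : P != 0.
  apply/eqP => P0; apply: nconst; exists x`_j; apply: subr0_eq.
  by rewrite -substP P0 /subst rmorph0.
have /countable_root : P.[int_poly R l] != 0.
  apply: horner_neq0 => // i; rewrite coefB coefZ mul_polyC.
  apply: leq_ltn_trans size_l; apply: leq_trans (size_polyD _ _) _.
  rewrite size_polyN geq_max leq_max leq_coef_size leq_max; apply/orP; right.
  exact: leq_trans (size_scale_leq _ _) (leq_coef_size _ _).
apply: sub_countable; apply: subset_card_le => c [[_ /= den0 xE] _].
rewrite /= /root subst_horner substP !hornerE xE run_rational //.
by rewrite divfK // subrr.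
Qed.

Lemma cantor_le_oracle : ([set: nat -> bool] #<= C)%card.
Proof.
have [e [e_inj e_bnd]] := cantor_interval R.
have e01 b : 0 < e b < 1 by have := e_bnd b; lra.
have [[c [c_bnd [c_reg c_y]]]|no_c] := pselect (exists c, 1 / 2 < c < 1 /\
    (regular c /\ forall y, 0 < y < 1 -> fresh c y ->
      exists d x, C x /\ varies_y c d y x)).
  apply: (cantor_le_of_cover e_inj (countable_stale c_reg) (G := varies_y c)).
    by move=> b /contrapT; apply: c_y.
  exact: countable_varies_y.
(* Now every regular [e b] has a fresh [y] for which no tuple of [C] varies with [y], so
   [query_varies] gives one varying with [c]. *)
apply: (cantor_le_of_cover e_inj countable_irregular (G := varies_c)).
  move=> b /contrapT c_reg; apply: contrapT => no_d; apply: no_c; exists (e b).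
  split=> //; split=> // y y01 y_fresh.
  by have [|/no_d] := query_varies (e_bnd b) y01 y_fresh.
exact: countable_varies_c.
Qed.

End Oracle.

Theorem theorem6p1 (R : realType) (C : set (seq R)) :
  bss_le (halting_problem R) C -> (C #= [set: nat -> bool])%card.
Proof.
move=> [M M_correct]; apply/card_eqPle; split; first exact: seq_card_le_cantor.
exact: cantor_le_oracle M_correct.
Qed.
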